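(* For any finite simple graph $G$ we have \[\operatorname{sum}(G)\geq\max_{k\geq 1}\bigl(\delta_{k}(G)+\delta_{k+1}(G)-k\bigr),\] where the maximum is over integers $k\geq 1$ with $k+1\leq |V(G)|$; that is, $\operatorname{sum}(G)\geq \delta_{k}(G)+\delta_{k+1}(G)-k$ for every such $k$.
   Context: For a finite simple graph $G$ and an injective labelling $f:V(G)\to\mathbb{Z}$, define $f_+(uv)=f(u)+f(v)$ for $uv\in E(G)$. The sum index $\operatorname{sum}(G)$ is the minimum, over all injective $f:V(G)\to\mathbb{Z}$, of the number of distinct values taken by $f_+$ on $E(G)$. For $1\leq j\leq |V(G)|$, $\delta_j(G)$ denotes the $j$th smallest vertex degree of $G$, i.e. the $j$th entry of the degree sequence of $G$ (with multiplicity) arranged in non-decreasing order. *)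

(* Defs.v *)
From mathcomp Require Import all_boot all_order all_algebra.
From mathcomp Require Import boolp.

Set Implicit Arguments.
Unset Strict Implicit.
Unset Printing Implicit Defensive.

Import Order.TTheory GRing.Theory Num.Theory.

Record sgraph := SGraph {
  svertex :> finType;
  sedge : rel svertex;
  sedge_sym : symmetric sedge;
  sedge_irrefl : irreflexive sedge }.

Definition degree (G : sgraph) (v : G) : nat := #|[set w | sedge v w]|.

Definition degree_sequence (G : sgraph) : seq nat :=
  sort leq [seq degree v | v <- enum G].

(* The index j is 1-based: meaningful for 1 <= j <= #|G|. *)
Definition delta (G : sgraph) (j : nat) : nat :=
  nth 0 (degree_sequence G) j.-1.

(* Each edge uv is listed as both (u, v) and (v, u); the two give the same sum,
   and repeated values are discarded anyway. *)
Definition edge_sums (G : sgraph) (f : G -> int) : seq int :=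
  undup [seq (f p.1 + f p.2)%R | p <- enum {: G * G} & sedge p.1 p.2].

Definition attains_sums (G : sgraph) (n : nat) : Prop :=
  exists f : G -> int, injective f /\ size (edge_sums f) = n.

Lemma attains_sums_ex (G : sgraph) : exists n, `[< attains_sums G n >].
Proof.
exists (size (edge_sums (fun v : G => Posz (enum_rank v)))); apply/asboolP.
exists (fun v : G => Posz (enum_rank v)); split => // u v [] /val_inj.
exact: enum_rank_inj.
Qed.

Definition sum_index (G : sgraph) : nat := ex_minn (attains_sums_ex G).

(* Main.v *)
(** Let [S] and [T] be the sets of vertices of degree at least [delta_k] and
    [delta_(k+1)]; at most [k-1] vertices lie outside [S], at most [k] outside
    [T].  For [f a < f b], the sums [f a + f w] with [f w <= f b] are smaller
    than the sums [f b + f w] with [f w > f a], so the number of sums is at least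
    [deg a + deg b - 1 - m], where [m] counts the labels outside
    [[f a, f b]].  Take [b] of largest label in [S].  If [b] is in [T], take [a]
    of smallest label in [S]: then [m <= k - 1].  Otherwise take [a] of smallest
    label in [T]: the [m] vertices avoid [T], and so does [b], which is not
    among them, whence again [m <= k - 1]. *)

Require Import Defs.
From mathcomp Require Import all_boot all_order all_algebra.
From mathcomp Require Import boolp zify.

Import Order.TTheory GRing.Theory Num.Theory.

(** Entries from position [i] on are at least the [i]th, so only the first [i] can be smaller. *)
Lemma count_ltn_nth_sorted (s : seq nat) (i : nat) :
  sorted leq s -> (count (fun x => x < nth 0 s i) s <= i)%N.
Proof.
move=> s_sorted; rewrite -[X in count _ X](cat_take_drop i s) count_cat.
have -> : count (fun x => x < nth 0 s i) (drop i s) = 0%N.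
  apply/eqP; rewrite -leqn0 leqNgt -has_count; apply/negP => /hasP[x].
  move=> /(nthP 0)[j]; rewrite size_drop nth_drop ltn_subRL => lt_ij <-.
  rewrite ltnNge => /negP; apply.
  apply: (sorted_leq_nth leq_trans leqnn) => //; rewrite ?inE ?leq_addr //.
  exact: leq_ltn_trans (leq_addr _ _) lt_ij.
by rewrite addn0 (leq_trans (count_size _ _)) // size_take; case: ltnP.
Qed.

Lemma card_degree_lt_delta (G : sgraph) (j : nat) :
  (#|[set v : G | degree v < delta G j]| <= j.-1)%N.
Proof.
rewrite cardsE cardE {1}/enum_mem -enumT size_filter.
have := count_ltn_nth_sorted _ j.-1 (sort_sorted leq_total [seq degree v | v <- enum G]).
by rewrite (permP (permEl (perm_sort _ _))) count_map.
Qed.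

Lemma mem_edge_sums (G : sgraph) (f : G -> int) (u v : G) :
  sedge u v -> (f u + f v)%R \in edge_sums f.
Proof.
move=> uv; rewrite mem_undup; apply/mapP; exists (u, v) => //.
by rewrite mem_filter uv mem_enum.
Qed.

Lemma degree_add_le_edge_sums (G : sgraph) (f : G -> int) (a b : G) :
  injective f -> (f a < f b)%R ->
  (degree a + degree b <=
     size (edge_sums f) + #|[set w | (f w < f a)%R || (f b < f w)%R]| + 1)%N.
Proof.
move=> f_inj lt_ab.
set L := [set w | (f w < f a)%R]; set U := [set w | (f b < f w)%R].
have -> : [set w | (f w < f a)%R || (f b < f w)%R] = L :|: U.
  by apply/setP => w; rewrite !inE.
have LU0 : L :&: U = set0 by apply/setP => w; rewrite !inE; apply/andP => -[]; lia.
rewrite cardsU LU0 cards0 subn0.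
(* [A] keeps the neighbours of [a] with label at most [f b], and [B] those of [b] with label above
   [f a]. Discarding [a] itself from [B] costs the extra 1 in the bound. *)
set A := [set w | sedge a w] :\: U; set B := [set w | sedge b w] :\: (a |: L).
have degA : (degree a <= #|A| + #|U|)%N.
  by rewrite /degree -(cardsID U) addnC leq_add2l subset_leq_card // subsetIr.
have degB : (degree b <= #|B| + (#|L| + 1))%N.
  rewrite /degree -(cardsID (a |: L)) addnC leq_add2l.
  apply: leq_trans (subset_leq_card (subsetIr _ _)) _.
  by rewrite cardsU1 addnC leq_add2l leq_b1.
suff : (#|A| + #|B| <= size (edge_sums f))%N by lia.
pose sA := [seq (f a + f w)%R | w <- enum A].
pose sB := [seq (f b + f w)%R | w <- enum B].
have -> : (#|A| + #|B| = size (sA ++ sB))%N by rewrite size_cat !size_map -!cardE.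
apply: uniq_leq_size.
  rewrite cat_uniq !map_inj_uniq ?enum_uniq ?andbT /=; first last.
  - by move=> x y /addrI /f_inj.
  - by move=> x y /addrI /f_inj.
  (* A common value is impossible: [f a + f u <= f a + f b < f w + f b]. *)
  apply/hasPn => _ /mapP[w wB ->]; apply/negP => /mapP[u uA].
  move: wB uA; rewrite !mem_enum !inE negb_or => /andP[/andP[wa Lw] _] /andP[Uu _].
  have : f w != f a by apply: contraNneq wa => /f_inj ->.
  lia.
move=> x; rewrite mem_cat => /orP[] /mapP[w]; rewrite mem_enum !inE.
  by move=> /andP[_ aw] ->; apply: mem_edge_sums.
by move=> /andP[_ bw] ->; apply: mem_edge_sums.
Qed.

Lemma exists_extremal_pair (G : sgraph) (f : G -> int) (k : nat) :
  injective f -> (1 <= k)%N -> (k + 1 <= #|G|)%N ->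
  exists a b : G,
    [/\ (f a < f b)%R,
        (delta G k + delta G (k + 1) <= degree a + degree b)%N
      & (#|[set w | (f w < f a)%R || (f b < f w)%R]| <= k - 1)%N].
Proof.
move=> f_inj k_gt0 k_lt.
(* [S'] and [T'] are the complements of the sets [S] and [T] of the overview. *)
set S' := [set v : G | degree v < delta G k].
set T' := [set v : G | degree v < delta G (k + 1)].
have cardS : (#|S'| <= k - 1)%N by rewrite subn1 card_degree_lt_delta.
have cardT : (#|T'| <= k)%N by rewrite (leq_trans (card_degree_lt_delta _ _)) // addn1.
have CS := cardsC S'; have CT := cardsC T'.
have [s0 Ss0] : exists s, s \in ~: S' by apply/card_gt0P; lia.
have [t0 Tt0] : exists t, t \in ~: T' by apply/card_gt0P; lia.
have [b Sb max_b] := arg_maxP f Ss0.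
have bmax w : w \in ~: S' -> (f w <= f b)%R by exact: max_b.
have degS v : v \in ~: S' -> (delta G k <= degree v)%N by rewrite !inE -leqNgt.
have degT v : v \in ~: T' -> (delta G (k + 1) <= degree v)%N by rewrite !inE -leqNgt.
have aboveS w : (f b < f w)%R -> w \in S'.
  by apply: contraTT; rewrite -in_setC => /bmax; rewrite -leNgt.
have [Tb|Tb] := boolP (b \in ~: T').
  have [a Sa amin] := arg_minP f Ss0.
  exists a, b; split.
  (* Equal extreme labels would leave one vertex outside [S'], but there are at least two, since
     [k + 1 <= #|G|]. *)
  - rewrite lt_neqAle (amin b Sb) andbT; apply/eqP => eq_ab.
    have /subset_leq_card : ~: S' \subset [set b].
      apply/subsetP => w Sw; rewrite inE; apply/eqP/f_inj/le_anti.
      by rewrite (bmax w Sw) -eq_ab; exact: amin.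
    by rewrite cards1; lia.
  - by rewrite leq_add ?degS ?degT.
  - apply: leq_trans cardS; apply/subset_leq_card/subsetP => w.
    rewrite inE => /orP[|/aboveS //].
    by apply: contraTT; rewrite -in_setC => /amin; rewrite -leNgt.
have [a Ta amin] := arg_minP f Tt0.
have sST : S' \subset T'.
  have size_degs : size (degree_sequence G) = #|G|.
    by rewrite size_sort size_map -cardE.
  (* Both indices must lie inside the degree sequence, as [nth] drops to 0 past its end. *)
  have delta_le : (delta G k <= delta G (k + 1))%N.
    rewrite /delta; apply: (sorted_leq_nth leq_trans leqnn); last by lia.
    - exact: sort_sorted leq_total _.
    - rewrite inE size_degs; lia.
    - rewrite inE size_degs; lia.
  by apply/subsetP => v; rewrite !inE => /leq_trans; apply.
have Sa : a \in ~: S' by rewrite -setCS in sST; apply: (subsetP sST).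
exists a, b; split.
- rewrite lt_neqAle (bmax a Sa) andbT.
  by apply: contraNneq Tb => /f_inj <-.
- by rewrite addnC leq_add ?degS ?degT.
rewrite inE negbK in Tb.
move: cardT; rewrite (cardsD1 b) Tb => cardT.
(* Since [b] lies in [T'], removing it brings the bound [k] down to [k - 1]. *)
apply: (@leq_trans #|T' :\ b|); last by lia.
apply/subset_leq_card/subsetP => w; rewrite in_setD1 inE => out.
apply/andP; split.
  apply: contraTneq out => ->; rewrite ltxx orbF -leNgt.
  exact: bmax.
case/orP: out => [|/aboveS /(subsetP sST) //].
by apply: contraTT; rewrite -in_setC => /amin; rewrite -leNgt.
Qed.

Theorem theorem3p2 (G : sgraph) (k : nat) (hk1 : (1 <= k)%N)
    (hk2 : (k + 1 <= #|G|)%N) :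
  (Posz (delta G k) + Posz (delta G (k + 1)) - Posz k
     <= Posz (sum_index G))%R.
Proof.
rewrite /sum_index; case: ex_minnP => n /asboolP[f [f_inj <-]] _.
have [a [b [lt_ab deg_ab out_ab]]] := exists_extremal_pair _ _ _ f_inj hk1 hk2.
have := degree_add_le_edge_sums _ _ _ _ f_inj lt_ab.
lia.
Qed.
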